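(* Let $m\ge 2$ be an integer and let $P_{-4}(c,z)=\sum_{n\ge 0}P_{-4,n}(c)z^n$ for $(c,z)\in(-1,1)\times[0,1)$, where $P_{-4,0}=1$, $P_{-4,1}=P_{-4,2}=P_{-4,3}=0$ and $$(km+m+4)\,P_{-4,k+4}(c)=2c\,((k-1)m+2)\,P_{-4,k+2}(c)-(k-3)m\,P_{-4,k}(c),\qquad k\ge 0 .$$ Write $v=\ln z$, so that $\frac{\partial}{\partial v}=z\frac{\partial}{\partial z}$. Then $P_{-4}=P_{-4}(c,z)$ satisfies, for $(c,z)\in(-1,1)\times(0,1)$, the fourth order linear PDE $$\begin{aligned} 0={}&m^2\left[4(1-c^2)\frac{\partial^2}{\partial c^2}-12c\frac{\partial}{\partial c}+\frac{\partial^2}{\partial v^2}+2\Bigl(\frac2m-3\Bigr)\frac{\partial}{\partial v}+4\Bigl(1-\frac2m\Bigr)\right]^2P_{-4}\\ &+16(m^2-8m)\frac{\partial^2P_{-4}}{\partial c^2}-16(2-m)^2\Bigl(c\frac{\partial}{\partial c}+1\Bigr)^2P_{-4}, \end{aligned}$$ with the boundary conditions $$P_{-4}(c,0)=1,\qquad \frac{\partial P_{-4}}{\partial z}(c,0)=\frac{\partial^2P_{-4}}{\partial z^2}(c,0)=\frac{\partial^3P_{-4}}{\partial z^3}(c,0)=0 .$$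
   Context: The square of a differential operator means the operator composed with itself. The generating function $P_{-4}(c,z)$ is the analytic function represented by the power series in $z$ in the claim (for $c\in(-1,1)$ its singularities in $z$ lie at the zeros of $1-2cz^2+z^4$, all of modulus $1$); derivatives at $z=0$ are those of the power series. *)

(* Defs.v *)
From Stdlib Require Import Reals.
From Coquelicot Require Import Coquelicot.
Open Scope R_scope.

Definition is_Pm4_coeffs (m : nat) (p : nat -> R -> R) : Prop :=
  forall c : R, -1 < c < 1 ->
    p 0%nat c = 1 /\ p 1%nat c = 0 /\ p 2%nat c = 0 /\ p 3%nat c = 0 /\
    forall k : nat,
      (INR k * INR m + INR m + 4) * p (k + 4)%nat c =
      2 * c * ((INR k - 1) * INR m + 2) * p (k + 2)%nat c
      - (INR k - 3) * INR m * p k c.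

Definition genfun (p : nat -> R -> R) (c z : R) : R :=
  PSeries (fun n => p n c) z.

Definition d_c (f : R -> R -> R) (c z : R) : R := Derive (fun t => f t z) c.

Definition d_z (f : R -> R -> R) (c z : R) : R := Derive (fun t => f c t) z.

(* Derivative with respect to v = ln z. *)
Definition d_v (f : R -> R -> R) (c z : R) : R := z * d_z f c z.

(* All iterated partial derivatives of f of order at most n, in every order of
   differentiation, exist on (-1,1) x (0,1).  [Derive] is total, so without
   this an equation between derivatives could hold for junk values. *)
Fixpoint partials_exist (n : nat) (f : R -> R -> R) : Prop :=
  match n with
  | O => True
  | S n' =>
      (forall c z : R, -1 < c < 1 -> 0 < z < 1 ->
         ex_derive (fun t => f t z) c /\ ex_derive (fun t => f c t) z) /\
      partials_exist n' (d_c f) /\ partials_exist n' (d_z f)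
  end.

Definition opL (m : nat) (f : R -> R -> R) (c z : R) : R :=
  4 * (1 - c ^ 2) * d_c (d_c f) c z - 12 * c * d_c f c z
  + d_v (d_v f) c z + 2 * (2 / INR m - 3) * d_v f c z
  + 4 * (1 - 2 / INR m) * f c z.

Definition opE (f : R -> R -> R) (c z : R) : R := c * d_c f c z + f c z.

(* Main.v *)
(** Put [mu = 2/m].  The coefficients [p_n] are associated Gegenbauer polynomials
    of parameter [-mu/2]; let [q_n] be the second solution of their recurrence, with
    [q_0 = 0] and [q_2 = 1].  The transfer matrix with rows [(q_{n+2}, p_{n+2})] and
    [(q_n, p_n)] intertwines the Gegenbauer connection at its two endpoints, so the
    first derivatives in [c] of its four entries are linear combinations of the
    entries.  Eliminating the shift in [n] leaves, with [E = c d/dc + 1] and [L] the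
    operator of the PDE acting on the coefficient of [z^n], the system

      [L p_n = 4 (3 q_n' + (1 - mu) E p_n)],
      [L q_n = (4 mu - 12) E q_n + (8 - 4 mu) q_n - (4 - 8 mu) p_n'],

    and eliminating [q_n] gives the fourth order equation for each [p_n].  The same
    first-order system reduces every [c]-derivative of [p_n] to [p_n], [q_n] and
    shifts, so all of them grow polynomially in [n], locally uniformly in [c], which
    justifies termwise differentiation. *)

Require Import Defs.
From Stdlib Require Import Reals Lra Lia ssreflect.
From Coquelicot Require Import Coquelicot.
Open Scope R_scope.

(** * The coefficient recurrence and its fundamental solutions *)

(** The recurrence of the coefficients divided by [m], with [mu] standing for [2/m]. The seeds at 1
    and 3 make every odd entry vanish, so [a] and [b], the values at 0 and 2, parametrise the
    solutions supported on even indices. *)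
Fixpoint gegen (mu a b c : R) (n : nat) : R :=
  match n with
  | 0 => a
  | 1 => 0
  | 2 => b
  | 3 => 0
  | S (S (S (S k) as j)) =>
      (2 * c * (INR k - 1 + mu) * gegen mu a b c j - (INR k - 3) * gegen mu a b c k)
      / (INR k + 1 + 2 * mu)
  end.

Lemma gegen_rec mu a b c k :
  gegen mu a b c (S (S (S (S k)))) =
  (2 * c * (INR k - 1 + mu) * gegen mu a b c (S (S k)) - (INR k - 3) * gegen mu a b c k)
  / (INR k + 1 + 2 * mu).
Proof. reflexivity. Qed.

Lemma nat_ind_step2 (Q : nat -> Prop) :
  Q 0%nat -> Q 1%nat -> (forall n, Q n -> Q (S (S n))) -> forall n, Q n.
Proof.
  intros H0 H1 HS n.
  enough (Q n /\ Q (S n)) by tauto.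
  induction n as [|n [IH1 IH2]]; auto.
Qed.

(** The leading coefficient [k m + m + 4] is positive, so the recurrence determines the sequence
    from its seeds. It links [n], [n + 2] and [n + 4], hence the induction carries a pair of entries
    and advances by two. *)
Lemma gegen_eq m (p : nat -> R -> R) c :
  (2 <= m)%nat -> is_Pm4_coeffs m p -> -1 < c < 1 ->
  forall n, p n c = gegen (2 / INR m) 1 0 c n.
Proof.
  intros hm hp hc.
  destruct (hp c hc) as (h0 & h1 & h2 & h3 & hr).
  assert (hmR : 2 <= INR m) by (apply (le_INR 2), hm).
  enough (H : forall n, p n c = gegen (2 / INR m) 1 0 c n /\
                        p (S (S n)) c = gegen (2 / INR m) 1 0 c (S (S n))).
  { intros n; apply H. }
  intros n; induction n as [| |n [IH1 IH2]] using nat_ind_step2; auto.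
  split; [exact IH2|].
  rewrite gegen_rec -IH1 -IH2.
  assert (E := hr n).
  replace (n + 4)%nat with (S (S (S (S n)))) in E by lia.
  replace (n + 2)%nat with (S (S n)) in E by lia.
  assert (hn := pos_INR n).
  assert (hpos : 0 < INR n * INR m + INR m + 4) by nra.
  apply (Rmult_eq_reg_l (INR n * INR m + INR m + 4)); [|lra].
  rewrite E; field; split; lra.
Qed.

Definition gegenP mu (n : nat) (c : R) := gegen mu 1 0 c n.
Definition gegenQ mu (n : nat) (c : R) := gegen mu 0 1 c n.

(** All four formulas are proved at once: the first two at [n + 2] are the last two at [n],
    rewritten by the recurrence, and the new last two come from differentiating the recurrence. The
    cross-term constants [3] and [2 mu - 1] belong to the fixed endpoint of the transfer matrix:
    they make the right sides vanish at [n = 0], where all four entries are constant in [c]. *)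
Lemma gegen_derive mu n c : 0 < mu -> -1 < c < 1 ->
  is_derive (gegenP mu n) c
    ((INR n * c * gegenP mu n c - (INR n - 1 + 2 * mu) * gegenP mu (S (S n)) c
      + 3 * gegenQ mu n c) / (2 * (1 - c ^ 2))) /\
  is_derive (gegenQ mu n) c
    (((INR n - 4 + 2 * mu) * c * gegenQ mu n c
      - (INR n - 1 + 2 * mu) * gegenQ mu (S (S n)) c
      + (2 * mu - 1) * gegenP mu n c) / (2 * (1 - c ^ 2))) /\
  is_derive (gegenP mu (S (S n))) c
    (((4 - INR n - 2 * mu) * c * gegenP mu (S (S n)) c + (INR n - 3) * gegenP mu n c
      + 3 * gegenQ mu (S (S n)) c) / (2 * (1 - c ^ 2))) /\
  is_derive (gegenQ mu (S (S n))) c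
    ((- INR n * c * gegenQ mu (S (S n)) c + (INR n - 3) * gegenQ mu n c
      + (2 * mu - 1) * gegenP mu (S (S n)) c) / (2 * (1 - c ^ 2))).
Proof.
  intros hmu hc.
  assert (hW : 1 - c ^ 2 <> 0) by nra.
  induction n as [| |n (H1 & H2 & H3 & H4)] using nat_ind_step2.
  - unfold gegenP, gegenQ; simpl gegen; simpl INR.
    refine (conj _ (conj _ (conj _ _))); (evar_last; [apply: is_derive_const|]);
      unfold zero; simpl; field; lra.
  - unfold gegenP, gegenQ; simpl gegen; simpl INR.
    refine (conj _ (conj _ (conj _ _))); (evar_last; [apply: is_derive_const|]);
      unfold zero; simpl; field; lra.
  - assert (hn := pos_INR n).
    assert (RP : forall t, gegenP mu (S (S (S (S n)))) t =
      (2 * t * (INR n - 1 + mu) * gegenP mu (S (S n)) t - (INR n - 3) * gegenP mu n t)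
      / (INR n + 1 + 2 * mu)) by (intros t; apply gegen_rec).
    assert (RQ : forall t, gegenQ mu (S (S (S (S n)))) t =
      (2 * t * (INR n - 1 + mu) * gegenQ mu (S (S n)) t - (INR n - 3) * gegenQ mu n t)
      / (INR n + 1 + 2 * mu)) by (intros t; apply gegen_rec).
    rewrite (RP c) (RQ c) !S_INR.
    split; [|split; [|split]].
    + evar_last; [exact H3|]; field; lra.
    + evar_last; [exact H4|]; field; lra.
    + apply (is_derive_ext _ _ _ _ (fun t => eq_sym (RP t))).
      evar_last.
      { apply: is_derive_scal_l. apply: is_derive_minus.
        - apply: is_derive_mult; [auto_derive; [exact I|reflexivity]|exact H3|apply Rmult_comm].
        - apply: is_derive_scal. exact H1. }
      unfold minus, plus, opp, mult, scal; simpl; unfold mult; simpl.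
      field; lra.
    + apply (is_derive_ext _ _ _ _ (fun t => eq_sym (RQ t))).
      evar_last.
      { apply: is_derive_scal_l. apply: is_derive_minus.
        - apply: is_derive_mult; [auto_derive; [exact I|reflexivity]|exact H4|apply Rmult_comm].
        - apply: is_derive_scal. exact H2. }
      unfold minus, plus, opp, mult, scal; simpl; unfold mult; simpl.
      field; lra.
Qed.

(** * Differential equations in [c] for each coefficient *)

Lemma locally_unit_interval (c : R) (Q : R -> Prop) :
  -1 < c < 1 -> (forall t, -1 < t < 1 -> Q t) -> locally c Q.
Proof.
  intros hc HQ.
  apply (locally_interval Q c (-1) 1); simpl; try lra.
  intros y h1 h2; apply HQ; simpl in *; lra.
Qed.

(** The operator [opL] seen on the coefficient of [z^n]: the part in [v] reduces to the scalar
    [kappa]. *)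
Definition lop (kappa : R) (y : R -> R) (c : R) : R :=
  4 * (1 - c ^ 2) * Derive (Derive y) c - 12 * c * Derive y c + kappa * y c.

Definition eop (y : R -> R) (c : R) : R := c * Derive y c + y c.

(** The eigenvalue on [z^n] of the part of [opL] in [v], where the [v]-derivative acts as
    multiplication by [n] and [2/m] is written [mu]. *)
Definition kappa (mu : R) (n : nat) : R := INR n ^ 2 + 2 * (mu - 3) * INR n + 4 * (1 - mu).

Lemma Derive_eq_on (f g : R -> R) c :
  (forall t, -1 < t < 1 -> f t = g t) -> -1 < c < 1 -> Derive f c = Derive g c.
Proof. intros H hc; apply Derive_ext_loc, locally_unit_interval; auto. Qed.

(** Differentiating the first-order system once more and substituting it back expresses both sides
    as combinations of the four transfer matrix entries, with coefficients rational in [c]; these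
    coefficients agree. *)
Lemma gegen_second_order mu n c : 0 < mu -> -1 < c < 1 ->
  lop (kappa mu n) (gegenP mu n) c =
    4 * (3 * Derive (gegenQ mu n) c + (1 - mu) * eop (gegenP mu n) c) /\
  lop (kappa mu n) (gegenQ mu n) c =
    (4 * mu - 12) * eop (gegenQ mu n) c + (8 - 4 * mu) * gegenQ mu n c
    - (4 - 8 * mu) * Derive (gegenP mu n) c.
Proof.
  intros hmu hc.
  destruct (gegen_derive mu n c hmu hc) as (H1 & H2 & H3 & H4).
  assert (hW : 1 - c ^ 2 <> 0) by nra.
  unfold lop, eop.
  rewrite (Derive_eq_on (Derive (gegenP mu n)) _ c
    (fun t ht => is_derive_unique _ _ _ (proj1 (gegen_derive mu n t hmu ht))) hc).
  rewrite (Derive_eq_on (Derive (gegenQ mu n)) _ c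
    (fun t ht => is_derive_unique _ _ _ (proj1 (proj2 (gegen_derive mu n t hmu ht)))) hc).
  rewrite (is_derive_unique _ _ _ H1) (is_derive_unique _ _ _ H2).
  set (p1 := gegenP mu n) in *; set (p2 := gegenP mu (S (S n))) in *.
  set (q1 := gegenQ mu n) in *; set (q2 := gegenQ mu (S (S n))) in *.
  split.
  - erewrite is_derive_unique.
    2: { auto_derive.
         - repeat split; try (eexists; eassumption); simpl in *; lra.
         - reflexivity. }
    change (Derive (fun x => p1 x) c) with (Derive p1 c).
    change (Derive (fun x => p2 x) c) with (Derive p2 c).
    change (Derive (fun x => q1 x) c) with (Derive q1 c).
    rewrite (is_derive_unique _ _ _ H1) (is_derive_unique _ _ _ H2) (is_derive_unique _ _ _ H3).
    unfold kappa; field; simpl in *; lra.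
  - erewrite is_derive_unique.
    2: { auto_derive.
         - repeat split; try (eexists; eassumption); simpl in *; lra.
         - reflexivity. }
    change (Derive (fun x => p1 x) c) with (Derive p1 c).
    change (Derive (fun x => q2 x) c) with (Derive q2 c).
    change (Derive (fun x => q1 x) c) with (Derive q1 c).
    rewrite (is_derive_unique _ _ _ H1) (is_derive_unique _ _ _ H2) (is_derive_unique _ _ _ H4).
    unfold kappa; field; simpl in *; lra.
Qed.

(** Write [D] for the [c]-derivative, [L] for [lop k] and [E] for [eop]. Applying [L] to the first
    equation gives [L L p = 12 L D q + 4 (1 - mu) L E p]. Commuting [L] with [D] in the second
    yields [L D q = - 4 (1 - mu) E D q - (4 - 8 mu) D^2 p], while [E] applied to the first gives
    [E L p = 12 E D q + 4 (1 - mu) E E p]. After [L] is commuted with [E], the two multiples of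
    [E D q] cancel. *)
Lemma fourth_order_of_system (k mu : R) (p q : R -> R) :
  (forall t, -1 < t < 1 ->
     ex_derive p t /\ ex_derive (Derive p) t /\ ex_derive (Derive (Derive p)) t) ->
  (forall t, -1 < t < 1 ->
     ex_derive q t /\ ex_derive (Derive q) t /\ ex_derive (Derive (Derive q)) t) ->
  (forall t, -1 < t < 1 ->
     lop k p t = 4 * (3 * Derive q t + (1 - mu) * eop p t) /\
     lop k q t = (4 * mu - 12) * eop q t + (8 - 4 * mu) * q t - (4 - 8 * mu) * Derive p t) ->
  forall c, -1 < c < 1 ->
  lop k (lop k p) c + 16 * (1 - 4 * mu) * Derive (Derive p) c
    - 16 * (1 - mu) ^ 2 * eop (eop p) c = 0.
Proof.
  intros hp hq hsys c hc.
  assert (Dep : forall t, -1 < t < 1 ->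
    is_derive (eop p) t (t * Derive (Derive p) t + 2 * Derive p t)).
  { intros t ht; destruct (hp t ht) as (e0 & e1 & e2); unfold eop.
    auto_derive; [tauto|]; change (Derive (fun x => p x)) with (Derive p);
    change (Derive (fun x => Derive p x)) with (Derive (Derive p)); ring. }
  assert (Deq : forall t, -1 < t < 1 ->
    is_derive (eop q) t (t * Derive (Derive q) t + 2 * Derive q t)).
  { intros t ht; destruct (hq t ht) as (e0 & e1 & e2); unfold eop.
    auto_derive; [tauto|]; change (Derive (fun x => q x)) with (Derive q);
    change (Derive (fun x => Derive q x)) with (Derive (Derive q)); ring. }
  assert (Dlp : forall t, -1 < t < 1 -> is_derive (lop k p) t
    (4 * (1 - t ^ 2) * Derive (Derive (Derive p)) t - 20 * t * Derive (Derive p) t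
     + (k - 12) * Derive p t)).
  { intros t ht; destruct (hp t ht) as (e0 & e1 & e2); unfold lop.
    auto_derive; [tauto|]; change (Derive (fun x => p x)) with (Derive p);
    change (Derive (fun x => Derive p x)) with (Derive (Derive p));
    change (Derive (fun x => Derive (Derive p) x)) with (Derive (Derive (Derive p))); ring. }
  assert (Dlq : forall t, -1 < t < 1 -> is_derive (lop k q) t
    (4 * (1 - t ^ 2) * Derive (Derive (Derive q)) t - 20 * t * Derive (Derive q) t
     + (k - 12) * Derive q t)).
  { intros t ht; destruct (hq t ht) as (e0 & e1 & e2); unfold lop.
    auto_derive; [tauto|]; change (Derive (fun x => q x)) with (Derive q);
    change (Derive (fun x => Derive q x)) with (Derive (Derive q));
    change (Derive (fun x => Derive (Derive q) x)) with (Derive (Derive (Derive q))); ring. }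
  assert (Dlp' : forall t, -1 < t < 1 -> Derive (lop k p) t =
    4 * (3 * Derive (Derive q) t + (1 - mu) * (t * Derive (Derive p) t + 2 * Derive p t))).
  { intros t ht; rewrite (Derive_eq_on _ _ t (fun s hs => proj1 (hsys s hs)) ht).
    apply is_derive_unique; destruct (hq t ht) as (e0 & e1 & e2).
    auto_derive; [split; [exact e1|split; [eexists; apply Dep, ht|exact I]]|].
    change (Derive (fun x => Derive q x)) with (Derive (Derive q)).
    rewrite (is_derive_unique _ _ _ (Dep t ht)); ring. }
  assert (Dlq' : Derive (lop k q) c = (4 * mu - 12) * (c * Derive (Derive q) c + 2 * Derive q c)
    + (8 - 4 * mu) * Derive q c - (4 - 8 * mu) * Derive (Derive p) c).
  { rewrite (Derive_eq_on _ _ c (fun s hs => proj2 (hsys s hs)) hc).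
    apply is_derive_unique; destruct (hq c hc) as (e0 & e1 & e2).
    destruct (hp c hc) as (e3 & e4 & e5).
    auto_derive; [split; [eexists; apply Deq, hc|tauto]|].
    change (Derive (fun x => Derive p x)) with (Derive (Derive p)).
    change (Derive (fun x => q x)) with (Derive q).
    rewrite (is_derive_unique _ _ _ (Deq c hc)); ring. }
  assert (DDlp : Derive (Derive (lop k p)) c =
    4 * (3 * Derive (Derive (Derive q)) c
         + (1 - mu) * (c * Derive (Derive (Derive p)) c + 3 * Derive (Derive p) c))).
  { rewrite (Derive_eq_on _ _ c Dlp' hc).
    apply is_derive_unique; destruct (hq c hc) as (e0 & e1 & e2).
    destruct (hp c hc) as (e3 & e4 & e5).
    auto_derive; [tauto|].
    change (Derive (fun x => Derive p x)) with (Derive (Derive p)).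
    change (Derive (fun x => Derive (Derive p) x)) with (Derive (Derive (Derive p))).
    change (Derive (fun x => Derive (Derive q) x)) with (Derive (Derive (Derive q))).
    ring. }
  assert (Eq1 := proj1 (hsys c hc)).
  assert (Eq1' := Dlp' c hc); rewrite (is_derive_unique _ _ _ (Dlp c hc)) in Eq1'.
  rewrite (is_derive_unique _ _ _ (Dlq c hc)) in Dlq'.
  (* The outer [lop] is evaluated on the right side of the first equation, so no derivative of order
     above three occurs. *)
  unfold lop at 1; rewrite DDlp (Dlp' c hc) Eq1.
  unfold eop at 2; rewrite (is_derive_unique _ _ _ (Dep c hc)).
  unfold lop in Eq1; unfold eop in *.
  (* [L E = E L + 8 (d/dc)^2] makes the second derivatives of [p] cancel. *)
  apply Rminus_diag_eq in Eq1, Eq1', Dlq'.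
  match type of Eq1 with ?a = 0 => match type of Eq1' with ?a' = 0 =>
  match type of Dlq' with ?b = 0 =>
    (* Here [a] is the first equation, [a'] its derivative and [b] the derivative of the second, so
       [c * a' + a] is [E] applied to the first equation. *)
    transitivity (12 * b + 4 * (1 - mu) * c * a' + 4 * (1 - mu) * a); [ring|]
  end end end.
  rewrite Eq1 Eq1' Dlq'; ring.
Qed.

(** * Sequences of functions of polynomial growth *)

(** Both [K] and [N] may depend on [d]: the exponent obtained below for [gegen] blows up as [d]
    tends to 1, yet any exponent still gives radius of convergence at least 1. *)
Definition poly_bounded (g : nat -> R -> R) : Prop :=
  forall d, 0 <= d < 1 -> exists K N, 0 <= K /\
    forall n c, Rabs c <= d -> Rabs (g n c) <= K * (INR n + 1) ^ N.

(** This class is closed under sums, products, shifts in [n] and, at the cost of one order,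
    [c]-derivatives; it contains [n], [c] and [1/(1 - c^2)]. A first-order system built from these
    therefore raises the order [k] by one. *)
Fixpoint tame (k : nat) (g : nat -> R -> R) : Prop :=
  match k with
  | O => poly_bounded g
  | S k' => poly_bounded g /\
      (forall n c, -1 < c < 1 -> ex_derive (g n) c) /\
      tame k' (fun n => Derive (g n))
  end.

Lemma tame_poly_bounded k g : tame k g -> poly_bounded g.
Proof. destruct k; simpl; tauto. Qed.

Lemma tame_pred k g : tame (S k) g -> tame k g.
Proof.
  revert g; induction k as [|k IH]; intros g H; [apply H|].
  destruct H as (Hb & He & Hd).
  split; [exact Hb|split; [exact He|apply IH, Hd]].
Qed.

Lemma poly_bounded_ext g h :
  (forall n c, -1 < c < 1 -> g n c = h n c) -> poly_bounded g -> poly_bounded h.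
Proof.
  intros E H d hd; destruct (H d hd) as (K & N & hK & B).
  exists K, N; split; [exact hK|]; intros n c hc.
  rewrite -E; [apply B, hc|].
  apply Rabs_le_between in hc; lra.
Qed.

Lemma tame_ext k g h :
  (forall n c, -1 < c < 1 -> g n c = h n c) -> tame k g -> tame k h.
Proof.
  revert g h; induction k as [|k IH]; intros g h E; simpl.
  { apply poly_bounded_ext, E. }
  intros (Hb & He & Hd).
  split; [exact (poly_bounded_ext _ _ E Hb)|split].
  - intros n c hc; apply (ex_derive_ext_loc (g n)); [|apply He, hc].
    apply locally_unit_interval; auto.
  - apply (IH _ _ (fun n c hc => Derive_ext_loc (g n) (h n) c
      (locally_unit_interval c _ hc (fun t ht => E n t ht))) Hd).
Qed.

(** Allows an explicit derivative formula, valid only on [(-1,1)], in place of [Derive]. *)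
Lemma tame_S k g g' :
  poly_bounded g -> (forall n c, -1 < c < 1 -> is_derive (g n) c (g' n c)) ->
  tame k g' -> tame (S k) g.
Proof.
  intros Hb Hd Ht; split; [exact Hb|split].
  - intros n c hc; exists (g' n c); apply Hd, hc.
  - apply (tame_ext k g'); [|exact Ht].
    intros n c hc; symmetry; apply is_derive_unique, Hd, hc.
Qed.

Lemma pow_add_bound (K1 K2 x : R) (N1 N2 : nat) :
  0 <= K1 -> 0 <= K2 -> 1 <= x ->
  K1 * x ^ N1 + K2 * x ^ N2 <= (K1 + K2) * x ^ (N1 + N2).
Proof.
  intros h1 h2 hx.
  assert (x ^ N1 <= x ^ (N1 + N2)) by (apply Rle_pow; [lra|lia]).
  assert (x ^ N2 <= x ^ (N1 + N2)) by (apply Rle_pow; [lra|lia]).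
  nra.
Qed.

Lemma poly_bounded_plus f g :
  poly_bounded f -> poly_bounded g -> poly_bounded (fun n c => f n c + g n c).
Proof.
  intros Hf Hg d hd.
  destruct (Hf d hd) as (K1 & N1 & h1 & B1), (Hg d hd) as (K2 & N2 & h2 & B2).
  exists (K1 + K2), (N1 + N2)%nat; split; [lra|]; intros n c hc.
  apply Rle_trans with (2 := pow_add_bound K1 K2 (INR n + 1) N1 N2 h1 h2
    ltac:(pose proof (pos_INR n); lra)).
  apply Rle_trans with (1 := Rabs_triang _ _).
  apply Rplus_le_compat; auto.
Qed.

Lemma poly_bounded_mult f g :
  poly_bounded f -> poly_bounded g -> poly_bounded (fun n c => f n c * g n c).
Proof.
  intros Hf Hg d hd.
  destruct (Hf d hd) as (K1 & N1 & h1 & B1), (Hg d hd) as (K2 & N2 & h2 & B2).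
  exists (K1 * K2), (N1 + N2)%nat; split; [nra|]; intros n c hc.
  rewrite Rabs_mult pow_add.
  replace (K1 * K2 * ((INR n + 1) ^ N1 * (INR n + 1) ^ N2)) with
    ((K1 * (INR n + 1) ^ N1) * (K2 * (INR n + 1) ^ N2)) by ring.
  apply Rmult_le_compat; auto using Rabs_pos.
Qed.

Lemma poly_bounded_succ g : poly_bounded g -> poly_bounded (fun n => g (S n)).
Proof.
  intros Hg d hd; destruct (Hg d hd) as (K & N & hK & B).
  (* The factor [2 ^ N] comes from [n + 2 <= 2 (n + 1)]. *)
  exists (K * 2 ^ N), N; split.
  { apply Rmult_le_pos; [exact hK|apply pow_le; lra]. }
  intros n c hc; apply Rle_trans with (1 := B (S n) c hc).
  rewrite Rmult_assoc -Rpow_mult_distr S_INR.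
  apply Rmult_le_compat_l; [exact hK|].
  apply pow_incr; pose proof (pos_INR n); lra.
Qed.

Lemma poly_bounded_cst a : poly_bounded (fun _ _ => a).
Proof.
  intros d hd; exists (Rabs a), 0%nat; split; [apply Rabs_pos|].
  intros n c hc; simpl; lra.
Qed.

Lemma tame_plus k f g : tame k f -> tame k g -> tame k (fun n c => f n c + g n c).
Proof.
  revert f g; induction k as [|k IH]; intros f g; [apply poly_bounded_plus|].
  intros (Bf & Ef & Df) (Bg & Eg & Dg).
  apply (tame_S k _ (fun n c => Derive (f n) c + Derive (g n) c)).
  - apply poly_bounded_plus; assumption.
  - intros n c hc; apply: is_derive_plus; apply Derive_correct; auto.
  - apply IH; assumption.
Qed.

Lemma tame_mult k f g : tame k f -> tame k g -> tame k (fun n c => f n c * g n c).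
Proof.
  revert f g; induction k as [|k IH]; intros f g; [apply poly_bounded_mult|].
  intros Hf Hg; pose proof (tame_pred _ _ Hf); pose proof (tame_pred _ _ Hg).
  destruct Hf as (Bf & Ef & Df), Hg as (Bg & Eg & Dg).
  apply (tame_S k _ (fun n c => Derive (f n) c * g n c + f n c * Derive (g n) c)).
  - apply poly_bounded_mult; assumption.
  - intros n c hc; apply: is_derive_mult; [apply Derive_correct; auto..|].
    apply Rmult_comm.
  - apply tame_plus; apply IH; assumption.
Qed.

Lemma tame_succ k g : tame k g -> tame k (fun n => g (S n)).
Proof.
  revert g; induction k as [|k IH]; intros g; [apply poly_bounded_succ|].
  intros (B & E & D); split; [apply poly_bounded_succ, B|split].
  - intros n; apply E.
  - exact (IH _ D).
Qed.

Lemma tame_cst k a : tame k (fun _ _ => a).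
Proof.
  revert a; induction k as [|k IH]; intros a; [apply poly_bounded_cst|].
  apply (tame_S k _ (fun _ _ => 0)); [apply poly_bounded_cst| |apply IH].
  intros n c _; apply: is_derive_const.
Qed.

Lemma tame_INR k : tame k (fun n _ => INR n).
Proof.
  assert (B : poly_bounded (fun n _ => INR n)).
  { intros d hd; exists 1, 1%nat; split; [lra|].
    intros n c _; rewrite Rabs_pos_eq; pose proof (pos_INR n); simpl; lra. }
  destruct k as [|k]; [exact B|].
  apply (tame_S k _ (fun _ _ => 0)); [exact B| |apply tame_cst].
  intros n c _; apply: is_derive_const.
Qed.

Lemma tame_id k : tame k (fun _ c => c).
Proof.
  assert (B : poly_bounded (fun _ c => c)).
  { intros d hd; exists 1, 0%nat; split; [lra|]; intros n c hc; simpl; lra. }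
  destruct k as [|k]; [exact B|].
  apply (tame_S k _ (fun _ _ => 1)); [exact B| |apply tame_cst].
  intros n c _; apply: is_derive_id.
Qed.

(** The derivative is [2 c] times the square of the function itself, so the order rises by induction
    through products. *)
Lemma tame_inv_one_minus_sq k : tame k (fun _ c => / (1 - c ^ 2)).
Proof.
  assert (B : poly_bounded (fun _ c => / (1 - c ^ 2))).
  { intros d hd; exists (/ (1 - d ^ 2)), 0%nat.
    assert (hd2 : 0 < 1 - d ^ 2) by nra.
    split; [left; apply Rinv_0_lt_compat, hd2|].
    intros n c hc; simpl (_ ^ 0); rewrite Rmult_1_r.
    assert (hcd : c ^ 2 <= d ^ 2).
    { rewrite -pow2_abs; apply pow_incr; split; [apply Rabs_pos|exact hc]. }
    rewrite Rabs_pos_eq; [|left; apply Rinv_0_lt_compat; lra].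
    apply Rinv_le_contravar; lra. }
  induction k as [|k IH]; [exact B|].
  apply (tame_S k _ (fun _ c => 2 * c * (/ (1 - c ^ 2) * / (1 - c ^ 2)))).
  - exact B.
  - intros n c hc; assert (1 - c ^ 2 <> 0) by nra.
    auto_derive; [simpl in *; lra|simpl; field; simpl in *; lra].
  - repeat apply tame_mult; try assumption; [apply tame_cst|apply tame_id].
Qed.

(* [energy c y_{n+2} y_n] is constant in [n] for the limiting recurrence
   [y_{n+4} = 2 c y_{n+2} - y_n], and definite for [|c| < 1]. *)
Definition energy (c x y : R) : R := x ^ 2 - 2 * c * x * y + y ^ 2.

(** The difference of the two sides is half of [(d - c) (x + y)^2 + (d + c) (x - y)^2]. *)
Lemma energy_lower d c x y :
  Rabs c <= d -> (1 - d) * (x ^ 2 + y ^ 2) <= energy c x y.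
Proof.
  intros hc; unfold energy; apply Rabs_le_between in hc.
  assert (0 <= (d - c) * (x + y) ^ 2) by (apply Rmult_le_pos; [lra|apply pow2_ge_0]).
  assert (0 <= (d + c) * (x - y) ^ 2) by (apply Rmult_le_pos; [lra|apply pow2_ge_0]).
  nra.
Qed.

(** Here [r] and [s] measure how far the true recurrence is from the limiting one, with [t] playing
    the role of [1/(n + 1)]. The perturbation [e] changes the energy by exactly
    [e (2 c x - 2 y + e)], which is of order [t (x^2 + y^2)] and is absorbed by [energy_lower]. The
    constant is [96 = 6 * 8 * 2], from the bounds [he], [hf] and [hsq]. *)
Lemma energy_perturb d c x y t r s :
  d < 1 -> Rabs c <= d -> 0 <= t <= 1 -> 0 <= r <= 3 * t -> 0 <= s <= 6 * t ->
  energy c (2 * c * (1 - r) * x - (1 - s) * y) x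
    <= (1 + 96 / (1 - d) * t) * energy c x y.
Proof.
  intros hd hc ht hr hs.
  set (e := - 2 * c * r * x + s * y).
  assert (hc1 : Rabs c <= 1) by lra.
  assert (he : Rabs e <= 6 * t * (Rabs x + Rabs y)).
  { unfold e; apply Rle_trans with (1 := Rabs_triang _ _).
    rewrite !Rabs_mult Rabs_Ropp (Rabs_pos_eq 2) ?(Rabs_pos_eq r) ?(Rabs_pos_eq s); try lra.
    pose proof (Rabs_pos x); pose proof (Rabs_pos y); pose proof (Rabs_pos c).
    assert (Rabs c * r <= 3 * t) by nra.
    nra. }
  assert (hf : Rabs (2 * c * x - 2 * y + e) <= 8 * (Rabs x + Rabs y)).
  { apply Rle_trans with (1 := Rabs_triang _ _).
    apply Rle_trans with (Rabs (2 * c * x) + Rabs (- (2 * y)) + Rabs e).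
    { apply Rplus_le_compat_r, Rabs_triang. }
    rewrite Rabs_Ropp !Rabs_mult (Rabs_pos_eq 2); [|lra].
    pose proof (Rabs_pos x); pose proof (Rabs_pos y); pose proof (Rabs_pos c).
    nra. }
  assert (E : energy c (2 * c * (1 - r) * x - (1 - s) * y) x
              = energy c x y + e * (2 * c * x - 2 * y + e)).
  { unfold energy, e; ring. }
  assert (hlow := energy_lower d c x y hc).
  assert (hsq : (Rabs x + Rabs y) ^ 2 <= 2 * (x ^ 2 + y ^ 2)).
  { rewrite -(pow2_abs x) -(pow2_abs y).
    pose proof (pow2_ge_0 (Rabs x - Rabs y)); nra. }
  assert (hprod : e * (2 * c * x - 2 * y + e) <= 96 * t * (x ^ 2 + y ^ 2)).
  { apply Rle_trans with (1 := Rle_abs _); rewrite Rabs_mult.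
    apply Rle_trans with ((6 * t * (Rabs x + Rabs y)) * (8 * (Rabs x + Rabs y))).
    - apply Rmult_le_compat; auto using Rabs_pos.
    - replace (6 * t * (Rabs x + Rabs y) * (8 * (Rabs x + Rabs y))) with
        (48 * t * (Rabs x + Rabs y) ^ 2) by ring.
      replace (96 * t * (x ^ 2 + y ^ 2)) with (48 * t * (2 * (x ^ 2 + y ^ 2))) by ring.
      apply Rmult_le_compat_l; lra. }
  assert (hE : x ^ 2 + y ^ 2 <= / (1 - d) * energy c x y).
  { apply (Rmult_le_reg_l (1 - d)); [lra|].
    rewrite -Rmult_assoc Rinv_r; lra. }
  rewrite E; unfold Rdiv.
  assert (96 * t * (x ^ 2 + y ^ 2) <= 96 * t * (/ (1 - d) * energy c x y)).
  { apply Rmult_le_compat_l; lra. }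
  lra.
Qed.

(** Each step of the recurrence multiplies the energy by at most [1 + M/(n + 1)], and the product of
    such factors grows like a power of [n]. *)
Lemma gegen_poly_bounded mu a b :
  0 < mu -> Rabs a <= 1 -> Rabs b <= 1 -> mu <= 1 ->
  poly_bounded (fun n c => gegen mu a b c n).
Proof.
  intros hmu ha hb hmu1 d hd.
  destruct (nfloor_ex (96 / (1 - d))) as [M0 [_ hM0]].
  { apply Rlt_le, Rdiv_lt_0_compat; lra. }
  set (M := S M0).
  assert (hM : 96 / (1 - d) <= INR M) by (unfold M; rewrite S_INR; lra).
  (* The energy is at most 4 at [n = 0], as [a], [b] and [c] are bounded by 1; then [y^2] costs a
     factor [1/(1 - d)], and [|y| <= 1 + y^2] avoids a square root. *)
  exists (1 + 4 / (1 - d)), M; split.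
  { assert (0 < 4 / (1 - d)) by (apply Rdiv_lt_0_compat; lra); lra. }
  intros n c hc.
  assert (hE : energy c (gegen mu a b c (S (S n))) (gegen mu a b c n) <= 4 * (INR n + 1) ^ M).
  { induction n as [| |n IH] using nat_ind_step2.
    - rewrite Rplus_0_l pow1; simpl gegen; unfold energy.
      assert (hc1 : Rabs c <= 1) by lra.
      apply Rabs_le_between in ha; apply Rabs_le_between in hb.
      apply Rabs_le_between in hc1.
      assert (- (c * (b * a)) <= 1).
      { apply Rabs_le_between in hc1.
        apply Rle_trans with (1 := Rle_abs _).
        rewrite Rabs_Ropp !Rabs_mult.
        assert (Rabs b <= 1) by (apply Rabs_le_between; lra).
        assert (Rabs a <= 1) by (apply Rabs_le_between; lra).
        pose proof (Rabs_pos a); pose proof (Rabs_pos b); pose proof (Rabs_pos c).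
        assert (Rabs b * Rabs a <= 1) by nra.
        assert (0 <= Rabs b * Rabs a) by nra.
        nra. }
      nra.
    - simpl gegen; unfold energy.
      assert (0 <= (INR 1 + 1) ^ M) by (apply pow_le; simpl; lra).
      lra.
    - assert (hn := pos_INR n).
      set (t := / (INR n + 1)).
      assert (ht : 0 < t) by (apply Rinv_0_lt_compat; lra).
      assert (ht1 : t * (INR n + 1) = 1) by (unfold t; field; lra).
      assert (ht2 : / (INR n + 1 + 2 * mu) <= t) by (apply Rinv_le_contravar; lra).
      assert (ht3 : 0 < / (INR n + 1 + 2 * mu)) by (apply Rinv_0_lt_compat; lra).
      (* The recurrence in perturbed form; [mu <= 1] gives [2 + mu <= 3] and [4 + 2 mu <= 6], the
         constants of [energy_perturb]. *)
      replace (gegen mu a b c (S (S (S (S n))))) with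
        (2 * c * (1 - (2 + mu) * / (INR n + 1 + 2 * mu)) * gegen mu a b c (S (S n))
         - (1 - (4 + 2 * mu) * / (INR n + 1 + 2 * mu)) * gegen mu a b c n)
        by (rewrite gegen_rec; field; lra).
      apply Rle_trans with
        ((1 + 96 / (1 - d) * t) * energy c (gegen mu a b c (S (S n))) (gegen mu a b c n)).
      { apply energy_perturb; try lra; nra. }
      (* Bernoulli: a factor [1 + M/(n+1)] is absorbed by [((n+2)/(n+1))^M]. *)
      assert (hfac : 1 + 96 / (1 - d) * t <= (1 + t) ^ M).
      { apply Rle_trans with (2 := poly M t ht); nra. }
      apply Rle_trans with ((1 + t) ^ M * (4 * (INR n + 1) ^ M)).
      { apply Rmult_le_compat; try assumption.
        - assert (0 < 96 / (1 - d)) by (apply Rdiv_lt_0_compat; lra); nra.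
        - apply Rle_trans with (2 := energy_lower d _ _ _ hc).
          apply Rmult_le_pos; [lra|nra]. }
      replace ((1 + t) ^ M * (4 * (INR n + 1) ^ M)) with
        (4 * ((1 + t) ^ M * (INR n + 1) ^ M)) by ring.
      rewrite -Rpow_mult_distr.
      apply Rmult_le_compat_l; [lra|].
      (* The product [(1 + t) (n + 1)] equals [n + 2], below the available [n + 3]. *)
      apply pow_incr; rewrite !S_INR; nra. }
  assert (hlow := Rle_trans _ _ _ (energy_lower d c _ _ hc) hE).
  set (y := gegen mu a b c n) in *; set (x := gegen mu a b c (S (S n))) in *.
  assert (hp : 1 <= (INR n + 1) ^ M).
  { apply pow_R1_Rle; pose proof (pos_INR n); lra. }
  assert (hy : y ^ 2 <= 4 / (1 - d) * (INR n + 1) ^ M).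
  { apply (Rmult_le_reg_l (1 - d)); [lra|].
    replace ((1 - d) * (4 / (1 - d) * (INR n + 1) ^ M)) with (4 * (INR n + 1) ^ M)
      by (field; lra).
    pose proof (pow2_ge_0 x); nra. }
  assert (Rabs y <= 1 + y ^ 2).
  { rewrite -(pow2_abs y); pose proof (pow2_ge_0 (Rabs y - 1)); pose proof (Rabs_pos y); nra. }
  lra.
Qed.

(** Order 0 is the energy bound. The first-order system mixes both solutions, so their orders are
    raised together. *)
Lemma gegen_tame mu : 0 < mu <= 1 -> forall k, tame k (gegenP mu) /\ tame k (gegenQ mu).
Proof.
  intros hmu k.
  assert (BP : poly_bounded (gegenP mu)).
  { apply gegen_poly_bounded; rewrite ?Rabs_R1 ?Rabs_R0; lra. }
  assert (BQ : poly_bounded (gegenQ mu)).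
  { apply gegen_poly_bounded; rewrite ?Rabs_R1 ?Rabs_R0; lra. }
  induction k as [|k [IHP IHQ]]; [split; assumption|].
  assert (Hd := fun n c hc => gegen_derive mu n c (proj1 hmu) hc).
  split.
  - apply (tame_S k _ _ BP (fun n c hc => proj1 (Hd n c hc))).
    (* Differences and quotients are spelled as sums and products so that the closure lemmas match;
       the shift by two is two applications of [tame_succ]. *)
    apply (tame_ext k (fun n c => ((INR n * c * gegenP mu n c
       + (-1) * ((INR n + (-1) + 2 * mu) * gegenP mu (S (S n)) c)) + 3 * gegenQ mu n c)
       * (/ 2 * / (1 - c ^ 2)))).
    { intros n c hc; field; nra. }
    repeat first [apply tame_plus|apply tame_mult|apply tame_cst|apply tame_INR
      |apply tame_id|apply tame_inv_one_minus_sq|assumption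
      |apply (tame_succ k (fun n => gegenP mu (S n)))|apply (tame_succ k (gegenP mu))].
  - apply (tame_S k _ _ BQ (fun n c hc => proj1 (proj2 (Hd n c hc)))).
    apply (tame_ext k (fun n c => (((INR n + (-4) + 2 * mu) * c * gegenQ mu n c
       + (-1) * ((INR n + (-1) + 2 * mu) * gegenQ mu (S (S n)) c))
       + (2 * mu + (-1)) * gegenP mu n c) * (/ 2 * / (1 - c ^ 2)))).
    { intros n c hc; field; nra. }
    repeat first [apply tame_plus|apply tame_mult|apply tame_cst|apply tame_INR
      |apply tame_id|apply tame_inv_one_minus_sq|assumption
      |apply (tame_succ k (fun n => gegenQ mu (S n)))|apply (tame_succ k (gegenQ mu))].
Qed.

(** * Termwise differentiation *)

Lemma ex_series_pow_geom N r : 0 < r < 1 -> ex_series (fun n => (INR n + 1) ^ N * r ^ n).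
Proof.
  intros hr.
  assert (hpos : forall n, 0 < INR n + 1) by (intros n; pose proof (pos_INR n); lra).
  apply ex_series_Rabs, (ex_series_DAlembert _ r); [lra| |].
  { intros n; apply Rmult_integral_contrapositive; split; apply pow_nonzero;
      [pose proof (hpos n)|]; lra. }
  apply (is_lim_seq_ext (fun n => (1 + / (INR n + 1)) ^ N * r)).
  { intros n; pose proof (hpos n); pose proof (hpos (S n)).
    assert (E : (INR (S n) + 1) ^ N = (1 + / (INR n + 1)) ^ N * (INR n + 1) ^ N).
    { rewrite -Rpow_mult_distr S_INR; f_equal; field; lra. }
    rewrite E -tech_pow_Rmult Rabs_pos_eq.
    - field; split; apply pow_nonzero; lra.
    - replace ((1 + / (INR n + 1)) ^ N * (INR n + 1) ^ N * (r * r ^ n) /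
         ((INR n + 1) ^ N * r ^ n)) with ((1 + / (INR n + 1)) ^ N * r).
      + apply Rmult_le_pos; [|lra]; apply pow_le.
        pose proof (Rinv_0_lt_compat _ (hpos n)); lra.
      + field; split; apply pow_nonzero; lra. }
  assert (L1 : is_lim_seq (fun n => 1 + / (INR n + 1)) 1).
  { evar_last; [apply: is_lim_seq_plus'; [apply is_lim_seq_const|]|].
    - apply (is_lim_seq_ext (fun n => / INR (S n))); [intros n; rewrite S_INR; reflexivity|].
      apply (is_lim_seq_incr_1 (fun n => / INR n)).
      replace (Finite 0) with (Rbar_inv p_infty) by reflexivity.
      apply is_lim_seq_inv; [apply is_lim_seq_INR|discriminate].
    - f_equal; lra. }
  evar_last; [apply: is_lim_seq_mult'; [|apply is_lim_seq_const]|].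
  - instantiate (1 := 1).
    clear -L1; induction N as [|N IH]; [apply is_lim_seq_const|].
    evar_last; [apply: is_lim_seq_mult'; [exact L1|exact IH]|f_equal; lra].
  - f_equal; lra.
Qed.

(** At [r] strictly between [|z|] and 1 the series converges, so its terms tend to 0, which is
    impossible outside the disk of convergence. *)
Lemma poly_bounded_CV_radius g c z :
  poly_bounded g -> -1 < c < 1 -> -1 < z < 1 ->
  Rbar_lt (Rabs z) (CV_radius (fun n => g n c)).
Proof.
  intros Hg hc hz.
  assert (hz1 : Rabs z < 1) by (apply Rabs_def1; lra).
  assert (hc1 : Rabs c < 1) by (apply Rabs_def1; lra).
  pose proof (Rabs_pos z); pose proof (Rabs_pos c).
  destruct (Hg (Rabs c)) as (K & N & hK & B); [lra|].
  set (r := (1 + Rabs z) / 2).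
  assert (hr : Rabs z < r < 1) by (unfold r; lra).
  apply (Rbar_lt_le_trans _ r); [apply hr|].
  apply Rbar_not_lt_le; intros Hlt.
  rewrite -(Rabs_pos_eq r) in Hlt; [|lra].
  apply (CV_disk_outside _ _ Hlt).
  enough (hs : ex_series (fun n => g n c * r ^ n)) by exact (ex_series_lim_0 _ hs).
  apply: (@ex_series_le R_AbsRing R_CompleteNormedModule _ (fun n => K * ((INR n + 1) ^ N * r ^ n))).
  - intros n; unfold norm; simpl; unfold abs; simpl.
    rewrite Rabs_mult -RPow_abs (Rabs_pos_eq r); [|lra].
    rewrite -Rmult_assoc; apply Rmult_le_compat_r; [apply pow_le; lra|].
    apply B; lra.
  - apply (ex_series_scal_l K (fun n => (INR n + 1) ^ N * r ^ n)).
    apply ex_series_pow_geom; lra.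
Qed.

(** Two uses of the mean value theorem write the remainder as [f''(eta) (xi - c) (t - c)] with
    [|xi - c| <= |t - c|]; hence the constant [M] rather than [M/2], without continuity of the
    second derivative. *)
Lemma taylor1_bound (f : R -> R) (c t M : R) :
  (forall x, Rmin c t <= x <= Rmax c t ->
     ex_derive f x /\ ex_derive (Derive f) x /\ Rabs (Derive (Derive f) x) <= M) ->
  Rabs (f t - f c - (t - c) * Derive f c) <= M * (t - c) ^ 2.
Proof.
  intros H.
  assert (hends : Rmin c t <= c <= Rmax c t).
  { split; [apply Rmin_l|apply Rmax_l]. }
  destruct (MVT_gen f c t (Derive f)) as (xi & hxi & E1).
  { intros x hx; apply Derive_correct, H; lra. }
  { intros x hx; apply continuity_pt_filterlim; apply: ex_derive_continuous; apply H, hx. }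
  assert (hsub : forall x, Rmin c xi <= x <= Rmax c xi -> Rmin c t <= x <= Rmax c t).
  { intros x; unfold Rmin, Rmax in *; repeat destruct Rle_dec; lra. }
  destruct (MVT_gen (Derive f) c xi (Derive (Derive f))) as (eta & heta & E2).
  { intros x hx; apply Derive_correct, H, hsub; lra. }
  { intros x hx; apply continuity_pt_filterlim; apply: ex_derive_continuous; apply H, hsub, hx. }
  destruct (H eta (hsub _ heta)) as (_ & _ & B).
  replace (f t - f c - (t - c) * Derive f c) with
    (Derive (Derive f) eta * ((xi - c) * (t - c))).
  2: { rewrite E1 -Rmult_assoc -E2; ring. }
  rewrite Rabs_mult; apply Rmult_le_compat; try apply Rabs_pos; [exact B|].
  rewrite Rabs_mult -(pow2_abs (t - c)); simpl; rewrite Rmult_1_r.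
  apply Rmult_le_compat_r; [apply Rabs_pos|].
  unfold Rmin, Rmax in hxi; destruct Rle_dec.
  - rewrite !Rabs_pos_eq; lra.
  - rewrite !Rabs_left1; lra.
Qed.


(** The first-order Taylor remainders of the terms are dominated by [w n * (t - c)^2] with [w]
    summable, so the summed remainder is quadratic in [t - c]. The order 2 of tameness supplies the
    bound on second derivatives. *)
Lemma genfun_is_derive_c g c z :
  tame 2 g -> -1 < c < 1 -> -1 < z < 1 ->
  is_derive (fun t => genfun g t z) c (genfun (fun n => Derive (g n)) c z).
Proof.
  intros (B0 & E0 & B1 & E1 & B2) hc hz.
  assert (hz1 : Rabs z < 1) by (apply Rabs_def1; lra).
  assert (hc1 : Rabs c < 1) by (apply Rabs_def1; lra).
  pose proof (Rabs_pos z); pose proof (Rabs_pos c).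
  (* The midpoint leaves room around [c] inside the region [|x| <= d < 1] where the second
     derivatives are bounded. *)
  set (d := (1 + Rabs c) / 2).
  destruct (B2 d) as (K & N & hK & B); [unfold d; lra|].
  set (r := (1 + Rabs z) / 2).
  assert (hr : Rabs z < r < 1) by (unfold r; lra).
  set (w := fun n => K * ((INR n + 1) ^ N * r ^ n)).
  assert (hw : ex_series w).
  { apply (ex_series_scal_l K (fun n => (INR n + 1) ^ N * r ^ n)).
    apply ex_series_pow_geom; lra. }
  assert (ex : forall f x, poly_bounded f -> -1 < x < 1 ->
    is_series (fun n => f n x * z ^ n) (genfun f x z)).
  { intros f x Hf hx; unfold genfun, PSeries; apply Series_correct.
    apply ex_series_Rabs, (CV_disk_inside (fun n => f n x)), poly_bounded_CV_radius; assumption. }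
  assert (key : forall t, Rabs t <= d ->
    Rabs (genfun g t z - genfun g c z - (t - c) * genfun (fun n => Derive (g n)) c z)
      <= Series w * (t - c) ^ 2).
  { intros t ht.
    assert (htd : -1 < t < 1) by (apply Rabs_le_between in ht; unfold d in ht; lra).
    assert (hs := is_series_minus _ _ _ _ (is_series_minus _ _ _ _ (ex g t B0 htd) (ex g c B0 hc))
      (is_series_scal_l (t - c) _ _ (ex _ c B1 hc))).
    assert (bound : forall n, Rabs (minus (minus (g n t * z ^ n) (g n c * z ^ n))
        (mult (t - c) (Derive (g n) c * z ^ n))) <= w n * (t - c) ^ 2).
    { intros n.
      replace (minus (minus (g n t * z ^ n) (g n c * z ^ n))
        (mult (t - c) (Derive (g n) c * z ^ n))) with
        ((g n t - g n c - (t - c) * Derive (g n) c) * z ^ n).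
      2: { unfold minus, plus, opp, mult; simpl; ring. }
      rewrite Rabs_mult -RPow_abs.
      replace (w n * (t - c) ^ 2) with ((K * (INR n + 1) ^ N * (t - c) ^ 2) * r ^ n)
        by (unfold w; ring).
      apply Rmult_le_compat; [apply Rabs_pos|apply pow_le; lra| |apply pow_incr; lra].
      apply taylor1_bound; intros x hx.
      assert (hxd : Rabs x <= d).
      { apply Rabs_le_between in ht.
        assert (hcd : Rabs c <= d) by (unfold d; lra).
        apply Rabs_le_between in hcd; apply Rabs_le_between.
        unfold Rmin, Rmax in hx; destruct Rle_dec; lra. }
      assert (hx1 : -1 < x < 1) by (apply Rabs_le_between in hxd; unfold d in hxd; lra).
      auto. }
    assert (hww := ex_series_scal_r ((t - c) ^ 2) w hw).
    assert (hab := @ex_series_le R_AbsRing R_CompleteNormedModule _ _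
      (fun n => Rle_trans _ _ _ (Req_le _ _ (Rabs_Rabsolu _)) (bound n)) hww).
    replace (genfun g t z - genfun g c z - (t - c) * genfun (fun n => Derive (g n)) c z)
      with (Series (fun n => minus (minus (g n t * z ^ n) (g n c * z ^ n))
        (mult (t - c) (Derive (g n) c * z ^ n)))) by (apply is_series_unique, hs).
    apply Rle_trans with (1 := Series_Rabs _ hab).
    rewrite -Series_scal_r; apply Series_le; [|exact hww].
    intros n; split; [apply Rabs_pos|apply bound]. }
  apply is_derive_Reals; intros eps heps.
  (* Read off from [key] at the point [d], which differs from [c]. *)
  assert (hS0 : 0 <= Series w).
  { assert (hd1 : Rabs d <= d) by (rewrite Rabs_pos_eq; unfold d; lra).
    assert (hk := Rle_trans _ _ _ (Rabs_pos _) (key d hd1)).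
    assert (0 < d - c) by (pose proof (Rle_abs c); unfold d; lra).
    assert (0 < (d - c) ^ 2) by (apply pow_lt; lra).
    apply (Rmult_le_reg_r ((d - c) ^ 2)); lra. }
  (* The first bound keeps [c + h] in the region of [key]; the second makes [Series w * |h|] smaller
     than [eps], the [+ 1] guarding against a zero sum. *)
  assert (hdel : 0 < Rmin (d - Rabs c) (eps / (Series w + 1))).
  { apply Rmin_glb_lt; [unfold d; lra|apply Rdiv_lt_0_compat; lra]. }
  exists (mkposreal _ hdel); simpl; intros h hh0 hh.
  assert (h1 : Rabs h < d - Rabs c) by (apply Rlt_le_trans with (1 := hh), Rmin_l).
  assert (h2 : Rabs h < eps / (Series w + 1)) by (apply Rlt_le_trans with (1 := hh), Rmin_r).
  assert (hk := key (c + h) ltac:(pose proof (Rabs_triang c h); lra)).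
  replace (c + h - c) with h in hk by ring.
  replace ((genfun g (c + h) z - genfun g c z) / h - genfun (fun n => Derive (g n)) c z)
    with ((genfun g (c + h) z - genfun g c z - h * genfun (fun n => Derive (g n)) c z) / h)
    by (field; exact hh0).
  assert (hhp := Rabs_pos_lt _ hh0).
  unfold Rdiv; rewrite Rabs_mult Rabs_inv.
  apply (Rmult_lt_reg_r (Rabs h)); [exact hhp|].
  rewrite Rmult_assoc Rinv_l ?Rmult_1_r; [|lra].
  apply Rle_lt_trans with (1 := hk).
  rewrite -(pow2_abs h).
  assert (Rabs h * (Series w + 1) < eps).
  { apply (Rmult_lt_reg_r (/ (Series w + 1))); [apply Rinv_0_lt_compat; lra|].
    rewrite Rmult_assoc Rinv_r ?Rmult_1_r; [exact h2|lra]. }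
  nra.
Qed.

(** * Differential operators acting on expansions in [z] *)

(** Tameness of every order is carried along with the identity so that the relation survives any
    number of derivatives in [c] or [z]. The identity is asked only on the open domain, which is
    enough since derivatives are local. *)
Definition expands (f : R -> R -> R) (g : nat -> R -> R) : Prop :=
  (forall k, tame k g) /\
  forall c z, -1 < c < 1 -> 0 < z < 1 -> f c z = genfun g c z.

Lemma genfun_ext g h c z : (forall n, g n c = h n c) -> genfun g c z = genfun h c z.
Proof. intros E; apply PSeries_ext, E. Qed.

Lemma tame_CV_radius k g c z : tame k g -> -1 < c < 1 -> 0 < z < 1 ->
  Rbar_lt (Rabs z) (CV_radius (fun n => g n c)).
Proof.
  intros H hc hz; apply poly_bounded_CV_radius; [apply (tame_poly_bounded k), H|exact hc|lra].
Qed.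

Lemma expands_ext f f' g g' :
  (forall c z, -1 < c < 1 -> 0 < z < 1 -> f c z = f' c z) ->
  (forall n c, -1 < c < 1 -> g n c = g' n c) -> expands f g -> expands f' g'.
Proof.
  intros Ef Eg [T E]; split; [intros k; apply (tame_ext k g); auto|].
  intros c z hc hz; rewrite -Ef // E //; apply genfun_ext; auto.
Qed.

Lemma expands_d_c f g : expands f g -> expands (d_c f) (fun n => Derive (g n)).
Proof.
  intros [T E]; split; [intros k; apply (T (S k))|].
  intros c z hc hz; unfold d_c.
  rewrite (Derive_eq_on _ (fun t => genfun g t z) c); [|intros t ht; apply E; assumption|exact hc].
  apply is_derive_unique, genfun_is_derive_c; [apply T|exact hc|lra].
Qed.

Lemma expands_is_derive_z f g c z : expands f g -> -1 < c < 1 -> 0 < z < 1 ->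
  is_derive (fun t => f c t) z (genfun (fun n c => INR (S n) * g (S n) c) c z).
Proof.
  intros [T E] hc hz.
  apply (is_derive_ext_loc (fun t => genfun g c t)).
  - apply (locally_interval _ z 0 1); simpl; try lra.
    intros y h1 h2; symmetry; apply E; simpl in *; lra.
  - apply (is_derive_PSeries (fun n => g n c)), (tame_CV_radius 0); auto.
Qed.

Lemma expands_d_z f g : expands f g -> expands (d_z f) (fun n c => INR (S n) * g (S n) c).
Proof.
  intros H; split.
  - intros k; apply (tame_mult k (fun n _ => INR (S n)) (fun n c => g (S n) c)).
    + apply (tame_succ k (fun n _ => INR n)), tame_INR.
    + apply (tame_succ k g), H.
  - intros c z hc hz; apply is_derive_unique, expands_is_derive_z; assumption.
Qed.

Lemma expands_partials f g : expands f g -> forall n, partials_exist n f.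
Proof.
  intros H n; revert f g H; induction n as [|n IH]; intros f g H; simpl; [exact I|].
  split; [|split; eapply IH; [apply expands_d_c, H|apply expands_d_z, H]].
  intros c z hc hz; split; [|eexists; apply (expands_is_derive_z f g); assumption].
  destruct H as [T E].
  apply (ex_derive_ext_loc (fun t => genfun g t z)).
  - apply locally_unit_interval; [exact hc|]; intros t ht; symmetry; auto.
  - eexists; apply genfun_is_derive_c; [apply T|exact hc|lra].
Qed.

Lemma expands_d_v f g : expands f g -> expands (d_v f) (fun n c => INR n * g n c).
Proof.
  intros H; split.
  - intros k; apply tame_mult; [apply tame_INR|apply H].
  - intros c z hc hz; unfold d_v.
    rewrite (proj2 (expands_d_z f g H) c z hc hz); unfold genfun.
    (* Multiplication by [z] undoes the index shift of [d_z]; the new zeroth coefficient is 0, in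
       agreement with [INR 0 * g 0 c]. *)
    rewrite -PSeries_incr_1; apply PSeries_ext; intros [|n]; unfold PS_incr_1; [|reflexivity].
    unfold zero; simpl; ring.
Qed.

Lemma expands_plus f1 f2 g1 g2 : expands f1 g1 -> expands f2 g2 ->
  expands (fun c z => f1 c z + f2 c z) (fun n c => g1 n c + g2 n c).
Proof.
  intros [T1 E1] [T2 E2]; split; [intros k; apply tame_plus; auto|].
  intros c z hc hz; rewrite E1 // E2 //; symmetry; apply (PSeries_plus (fun n => g1 n c));
    apply CV_radius_inside, (tame_CV_radius 0); auto.
Qed.

Lemma expands_mult a f g : (forall k, tame k (fun _ => a)) -> expands f g ->
  expands (fun c z => a c * f c z) (fun n c => a c * g n c).
Proof.
  intros Ta [T E]; split; [intros k; apply tame_mult; auto|].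
  intros c z hc hz; rewrite E //; symmetry; apply (PSeries_scal (a c) (fun n => g n c)).
Qed.

Lemma expands_opL m f g : expands f g ->
  expands (opL m f) (fun n => lop (kappa (2 / INR m) n) (g n)).
Proof.
  intros H; set (mu := 2 / INR m).
  assert (Hc := expands_d_c _ _ H); assert (Hv := expands_d_v _ _ H).
  assert (Ta : forall k, tame k (fun (_ : nat) c => 4 + (-4) * (c * c))).
  { intros k; apply tame_plus; [apply tame_cst|].
    repeat apply tame_mult; try apply tame_cst; apply tame_id. }
  assert (Tb : forall k, tame k (fun (_ : nat) c => (-12) * c)).
  { intros k; apply tame_mult; [apply tame_cst|apply tame_id]. }
  refine (expands_ext _ _ _ _ _ _ (expands_plus _ _ _ _
    (expands_plus _ _ _ _ (expands_mult _ _ _ Ta (expands_d_c _ _ Hc)) (expands_mult _ _ _ Tb Hc))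
    (expands_plus _ _ _ _ (expands_d_v _ _ Hv) (expands_plus _ _ _ _
      (expands_mult (fun _ => 2 * (mu - 3)) _ _ (fun k => tame_cst k _) Hv)
      (expands_mult (fun _ => 4 * (1 - mu)) _ _ (fun k => tame_cst k _) H))))).
  - intros c z _ _; unfold opL, mu; simpl; unfold Rdiv; ring.
  - intros n c _; unfold lop, kappa; simpl; ring.
Qed.

Lemma expands_opE f g : expands f g -> expands (opE f) (fun n => eop (g n)).
Proof.
  intros H.
  refine (expands_ext _ _ _ _ _ _ (expands_plus _ _ _ _
    (expands_mult (fun c => c) _ _ tame_id (expands_d_c _ _ H)) H));
  reflexivity.
Qed.

Theorem corollary2p2 (m : nat) (hm : (2 <= m)%nat) (p : nat -> R -> R)
    (hp : is_Pm4_coeffs m p) :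
  let P := genfun p in
  (forall c z : R, -1 < c < 1 -> 0 <= z < 1 -> ex_pseries (fun n => p n c) z) /\
  partials_exist 4 P /\
  (forall c z : R, -1 < c < 1 -> 0 < z < 1 ->
     0 = INR m ^ 2 * opL m (opL m P) c z
         + 16 * (INR m ^ 2 - 8 * INR m) * d_c (d_c P) c z
         - 16 * (2 - INR m) ^ 2 * opE (opE P) c z) /\
  (forall c : R, -1 < c < 1 ->
     P c 0 = 1 /\
     is_derive_n (fun z => P c z) 1 0 0 /\
     is_derive_n (fun z => P c z) 2 0 0 /\
     is_derive_n (fun z => P c z) 3 0 0).
Proof.
  intros P.
  assert (hmR : 2 <= INR m) by (apply (le_INR 2), hm).
  set (mu := 2 / INR m).
  assert (hmm : INR m * mu = 2) by (unfold mu; field; lra).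
  assert (hmu : 0 < mu <= 1).
  { split; [apply Rdiv_lt_0_compat; lra|].
    apply (Rmult_le_reg_l (INR m)); lra. }
  assert (HT := gegen_tame mu hmu).
  assert (Ep := fun n c hc => gegen_eq m p c hm hp hc n).
  assert (Tp : forall k, tame k p).
  { intros k; apply (tame_ext k (gegenP mu)); [|apply HT].
    intros n c hc; symmetry; apply Ep, hc. }
  assert (HP : expands P (gegenP mu)).
  { split; [intros k; apply HT|]; intros c z hc hz; apply genfun_ext; intros n; apply Ep, hc. }
  split; [|split; [exact (expands_partials P _ HP 4)|split]].
  - intros c z hc hz; apply CV_radius_inside, poly_bounded_CV_radius; [apply (Tp 0%nat)|lra..].
  - intros c z hc hz.
    (* The whole right side of the PDE becomes one generating function; it remains to see that each
       of its coefficients vanishes. *)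
    assert (H := expands_plus _ _ _ _ (expands_plus _ _ _ _
      (expands_mult (fun _ => INR m ^ 2) _ _ (fun k => tame_cst k _)
        (expands_opL m _ _ (expands_opL m _ _ HP)))
      (expands_mult (fun _ => 16 * (INR m ^ 2 - 8 * INR m)) _ _ (fun k => tame_cst k _)
        (expands_d_c _ _ (expands_d_c _ _ HP))))
      (expands_mult (fun _ => - (16 * (2 - INR m) ^ 2)) _ _ (fun k => tame_cst k _)
        (expands_opE _ _ (expands_opE _ _ HP)))).
    assert (E := proj2 H c z hc hz); simpl in E.
    transitivity (genfun (fun _ _ => 0) c z).
    { symmetry; unfold genfun; rewrite (PSeries_ext _ (PS_scal 0 (fun _ => 0))).
      - rewrite PSeries_scal; ring.
      - intros n; unfold PS_scal, scal; simpl; unfold mult; simpl; ring. }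
    etransitivity; [|etransitivity; [symmetry; exact E|simpl; ring]].
    apply genfun_ext; intros n; fold mu.
    (* Order 3 unfolds to the three successive derivatives required by the elimination. *)
    destruct (HT 3%nat) as [(_ & eP0 & _ & eP1 & _ & eP2 & _) (_ & eQ0 & _ & eQ1 & _ & eQ2 & _)].
    assert (F := fourth_order_of_system (kappa mu n) mu (gegenP mu n) (gegenQ mu n)
      (fun t ht => conj (eP0 n t ht) (conj (eP1 n t ht) (eP2 n t ht)))
      (fun t ht => conj (eQ0 n t ht) (conj (eQ1 n t ht) (eQ2 n t ht)))
      (fun t ht => gegen_second_order mu n t (proj1 hmu) ht) c hc).
    set (a := lop _ _ _) in *; set (b := Derive _ _) in *; set (e := eop _ _) in *.
    (* Since [m mu = 2], one has [m^2 - 8 m = m^2 (1 - 4 mu)] and [(2 - m)^2 = m^2 (1 - mu)^2]: the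
       coefficient is [m^2] times the fourth order expression. *)
    replace (16 * (INR m * (INR m * 1) - 8 * INR m)) with (16 * INR m ^ 2 * (1 - 4 * mu)).
    2: { replace 8 with (4 * 2) by ring; rewrite -{1}hmm; ring. }
    replace (- (16 * ((2 - INR m) * ((2 - INR m) * 1)))) with (- (16 * INR m ^ 2 * (1 - mu) ^ 2)).
    2: { rewrite -hmm; ring. }
    transitivity (INR m ^ 2 * 0); [ring|rewrite -F; ring].
  - intros c hc.
    destruct (hp c hc) as (h0 & h1 & h2 & h3 & _).
    assert (hr : Rbar_lt (Rabs 0) (CV_radius (fun n => p n c))).
    { apply poly_bounded_CV_radius; [apply (Tp 0%nat)|lra..]. }
    (* The derivative of order [j] at 0 is [j!] times the coefficient [p j c]; it is two-sided, the
       series converging also for negative [z]. *)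
    assert (hD : forall j, p j c = 0 -> is_derive_n (fun z => P c z) j 0 0).
    { intros j hj; evar_last; [exact (is_derive_n_PSeries j (fun n => p n c) 0 hr)|].
      rewrite PSeries_0; unfold PS_derive_n; rewrite Nat.add_0_l hj; ring. }
    split; [unfold P, genfun; rewrite PSeries_0; exact h0|].
    split; [|split]; apply hD; assumption.
Qed.
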